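(* Let $n,k,t$ be integers with $0<t<k\leq n$ such that $n>(k-t)\binom{k^2}{t+1}+t$. Let $\mathcal{F}$ be a $t$-intersecting, $k$-uniform family of subsets of $[n]$. Suppose that $$ |\mathcal{F}|=\binom{n-t}{k-t}. $$ Then there exists a subset $T\subseteq[n]$ with $|T|=t$ such that $T\subseteq F$ for each $F\in\mathcal{F}$.
   Context: $[n]=\{1,2,\ldots,n\}$. A family $\mathcal{F}$ is a set of (distinct) subsets of $[n]$. A family $\mathcal{F}$ is $k$-uniform if $|F|=k$ for each $F\in\mathcal{F}$. A family $\mathcal{F}$ is $t$-intersecting if $|F\cap F'|\geq t$ whenever $F,F'\in\mathcal{F}$. *)

(* Defs.v *)
From mathcomp Require Import all_boot.

Set Implicit Arguments.
Unset Strict Implicit.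
Unset Printing Implicit Defensive.

(* The ground set [n] = {1, ..., n} is represented by 'I_n = {0, ..., n - 1}. *)

Definition uniform (n k : nat) (F : {set {set 'I_n}}) : Prop :=
  forall A : {set 'I_n}, A \in F -> #|A| = k.

Definition t_intersecting (n t : nat) (F : {set {set 'I_n}}) : Prop :=
  forall A B : {set 'I_n}, A \in F -> B \in F -> t <= #|A :&: B|.

(* Main.v *)
Require Import Defs.
From mathcomp Require Import all_boot zify.

Set Implicit Arguments.
Unset Strict Implicit.
Unset Printing Implicit Defensive.

(** Suppose that no [t]-set lies in all members of [F].  Then [F] has fewer
    than ['C(n - t, k - t)] members, because they all contain more than [t]
    points of one small set [S] ([small_kernel]).

    If every two members meet in more than [t] points, any member serves as [S].
    Otherwise let [A] and [B] be members with exactly [t] common points, and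
    [C] a member that omits one of these points.  A member that misses a common
    point of [A] and [B] has to make up for it twice, once in [A] and once in
    [B] ([meets_union_of_pair]); a member that contains [A :&: B] has to meet
    [C] outside [A :&: B].  So the union of [A], [B] and [C] serves as [S], and
    it has at most [3 * (k - 1) <= k ^ 2] points.

    Each member of [F] thus contains one of the at most ['C(k ^ 2, t.+1)] sets
    of [t.+1] points of [S], and each of these lies in only
    ['C(n - t.+1, k - t.+1)] sets of size [k], so [F] has at most
    ['C(k ^ 2, t.+1) * 'C(n - t.+1, k - t.+1)] members
    ([card_family_kernel]).  As
    [(k - t) * 'C(n - t, k - t) = (n - t) * 'C(n - t.+1, k - t.+1)], the
    assumption on [n] says exactly that this bound is below
    ['C(n - t, k - t)]. *)

(** Removing [U] embeds these sets into the subsets of [~: U] with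
    [k - #|U|] points. *)
Lemma card_supersets_le (T : finType) (U : {set T}) (k : nat) :
  #|[set A : {set T} | (U \subset A) && (#|A| == k)]|
    <= 'C(#|T| - #|U|, k - #|U|).
Proof.
have -> : #|T| - #|U| = #|~: U| by rewrite [RHS]cardsCs setCK.
rewrite -cards_draws.
rewrite -(@card_in_imset _ _ (fun A => A :\: U)); last first.
  move=> A B; rewrite !inE => /andP[/setIidPr UA _] /andP[/setIidPr UB _] eqD.
  by rewrite -(setID A U) -(setID B U) UA UB eqD.
apply/subset_leq_card/subsetP => _ /imsetP[A + ->].
rewrite !inE => /andP[UA /eqP <-].
by rewrite setDE subsetIr /= -setDE cardsDS.
Qed.

(** Each member of [F] contains one of the [m]-subsets of [S], so [F] is covered
    by the families of [k]-sets above these subsets. *)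
Lemma card_family_kernel (T : finType) (F : {set {set T}}) (S : {set T})
    (k m : nat) :
    (forall A, A \in F -> #|A| = k) ->
    (forall A, A \in F -> m <= #|A :&: S|) ->
  #|F| <= 'C(#|S|, m) * 'C(#|T| - m, k - m).
Proof.
move=> Fk FS; rewrite -cards_draws.
set P := [set U : {set T} | _].
pose G (U : {set T}) := [set A : {set T} | (U \subset A) && (#|A| == k)].
have FG : F \subset \bigcup_(U in P) G U.
  apply/subsetP => A AF.
  have := FS A AF; rewrite -bin_gt0 -cards_draws card_gt0.
  case/set0Pn => U; rewrite inE subsetI => /andP[/andP[UA US] Um].
  by apply/bigcupP; exists U; rewrite inE ?US ?UA ?(Fk A AF) ?eqxx.
apply: leq_trans (subset_leq_card FG) _.
apply: leq_trans (_ : \sum_(U in P) #|G U| <= _).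
  apply: (big_ind2 (fun (X : {set {set T}}) s => #|X| <= s)) => //.
    by rewrite cards0.
  move=> X a Y b leXa leYb; apply: leq_trans (leq_add leXa leYb).
  exact: (leq_card_setU X Y).1.
rewrite -sum_nat_const; apply: leq_sum => U; rewrite inE => /andP[_ /eqP <-].
exact: card_supersets_le.
Qed.

(** Let [D] miss [s] of the [t] points of [A :&: B].  It then has at least [s]
    points in each of the disjoint sets [A :\: B] and [B :\: A], hence at least
    [(t - s) + 2 * s] points in the union. *)
Lemma meets_union_of_pair (T : finType) (t : nat) (A B D : {set T}) :
    #|A :&: B| = t -> t <= #|D :&: A| -> t <= #|D :&: B| ->
    ~~ (A :&: B \subset D) ->
  t < #|D :&: (A :|: B)|.
Proof.
move=> ABt DA DB ABD.
have lt : #|D :&: (A :&: B)| < t.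
  rewrite -ABt; apply: proper_card.
  by rewrite properEneq subsetIr andbT; apply: contra ABD => /eqP/setIidPr.
have := cardsUI (D :&: A) (D :&: B).
rewrite -setIUr -setIIr; lia.
Qed.

(** The bound [k ^ 2] is what the counting uses; the union of [A], [B] and [C]
    has at most [3 * k - 2 * t - 1] points, since [C] itself omits a point of
    [A :&: B] and so shares more than [t] points with [A :|: B]. *)
Lemma small_kernel (T : finType) (F : {set {set T}}) (k t : nat) :
    0 < t < k ->
    (forall A, A \in F -> #|A| = k) ->
    (forall A B, A \in F -> B \in F -> t <= #|A :&: B|) ->
    (forall U : {set T}, #|U| = t -> exists2 A, A \in F & ~~ (U \subset A)) ->
  exists2 S : {set T}, #|S| <= k ^ 2 & forall A, A \in F -> t < #|A :&: S|.
Proof.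
move=> /andP[t0 tk] Fk Ft F_nontriv.
case: (set_0Vmem F) => [F0|[A AF]].
  by exists set0 => [|A]; rewrite ?cards0 // F0 inE.
case: (boolP [forall B in F, t < #|B :&: A|]) => [/forall_inP all_gt|].
  by exists A; rewrite // Fk //; nia.
rewrite negb_forall_in => /exists_inP[B BF leBA].
have ABt : #|A :&: B| = t by have := Ft A B AF BF; rewrite setIC; lia.
have [C CF nABC] := F_nontriv _ ABt.
exists (C :|: (A :|: B)) => [|D DF].
  have gtC := meets_union_of_pair ABt (Ft C A CF AF) (Ft C B CF BF) nABC.
  have := cardsUI C (A :|: B); have := cardsUI A B.
  rewrite ABt (Fk A AF) (Fk B BF) (Fk C CF) => ? ?.
  (* 3 k - 3 <= k ^ 2 because k ^ 2 - 3 k + 3 has negative discriminant. *)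
  nia.
have [ABD|nABD] := boolP (A :&: B \subset D); last first.
  have gtD := meets_union_of_pair ABt (Ft D A DF AF) (Ft D B DF BF) nABD.
  apply: leq_trans gtD _.
  by rewrite subset_leq_card // setIS // subsetUr.
(* [D :&: C] has at least t points, but [C] has fewer than t of the points of
   [A :&: B], so [D] has a point of [C] besides all of [A :&: B]. *)
rewrite -ABt; apply: proper_card; rewrite properEneq.
have sub : A :&: B \subset D :&: (C :|: (A :|: B)).
  by rewrite subsetI ABD (subset_trans (subsetIl A B)) // setUCA subsetUl.
rewrite sub andbT; apply/eqP => eqAB.
have DCAB : D :&: C \subset A :&: B by rewrite eqAB setIS // subsetUl.
have eqDC : D :&: C = A :&: B.
  by apply/eqP; rewrite eqEcard DCAB ABt Ft.
by case/negP: nABC; rewrite -eqDC subsetIr.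
Qed.

Theorem corollary1p15 (n k t : nat) (F : {set {set 'I_n}})
    (ht : 0 < t) (htk : t < k) (hkn : k <= n)
    (hn : (k - t) * 'C(k ^ 2, t.+1) + t < n)
    (hint : t_intersecting t F)
    (hunif : uniform k F)
    (hcard : #|F| = 'C(n - t, k - t)) :
  exists T : {set 'I_n}, #|T| = t /\ (forall A : {set 'I_n}, A \in F -> T \subset A).
Proof.
case: (boolP [exists T : {set 'I_n},
                (#|T| == t) && [forall A in F, T \subset A]]).
  by case/existsP => T /andP[/eqP Tt /forall_inP TF]; exists T.
rewrite negb_exists => /forallP no_T.
have [|U Ut|S Sk FS] := @small_kernel _ F k t _ hunif hint; first by rewrite ht.
  by have := no_T U; rewrite Ut eqxx negb_forall_in => /exists_inP.
have := card_family_kernel hunif FS; rewrite hcard card_ord.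
have := leq_bin2l t.+1 Sk.
have : 0 < 'C(n - t.+1, k - t.+1) by rewrite bin_gt0; lia.
have := mul_bin_diag (n - t) (k - t.+1).
have -> : (n - t).-1 = n - t.+1 by lia.
have -> : (k - t.+1).+1 = k - t by lia.
set c := 'C(n - t.+1, _) => diag c_gt0 le_bin le_F.
have le_kF : (k - t) * 'C(n - t, k - t) <= (k - t) * 'C(k ^ 2, t.+1) * c.
  by rewrite -mulnA leq_mul2l (leq_trans le_F) ?orbT // leq_mul2r le_bin orbT.
have : (k - t) * 'C(k ^ 2, t.+1) * c < (n - t) * c.
  by rewrite ltn_pmul2r // ltn_subRL addnC.
by rewrite diag ltnNge le_kF.
Qed.
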